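(* There exist arbitrarily large finite metric spaces $X$ for which $c_1(X)=\Omega(\log|X|)$. That is, there is a universal constant $c>0$ such that for every $N\in\mathbb{N}$ there is a finite metric space $X$ with $|X|\ge N$ and $c_1(X)\ge c\log|X|$.
   Context: Distortion: for metric spaces $(X,d_X),(Y,d_Y)$ and $f:X\to Y$, $\|f\|_{\mathrm{Lip}}=\sup_{x\ne y} d_Y(f(x),f(y))/d_X(x,y)$. If $f$ is one-to-one, $\mathrm{dist}(f)=\|f\|_{\mathrm{Lip}}\cdot\|f^{-1}\|_{\mathrm{Lip}}$ (with $f^{-1}$ defined on $f(X)$); otherwise $\mathrm{dist}(f)=\infty$. $c_Y(X)=\inf\{\mathrm{dist}(f): f:X\to Y\}$, and $c_1(X)=c_{L_1}(X)$, where $L_1=L_1([0,1])$. *)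

(* Defs.v *)
From HB Require Import structures.
From mathcomp Require Import all_boot all_order all_algebra.
From mathcomp Require Import all_classical all_reals all_analysis.

Set Implicit Arguments.
Unset Strict Implicit.
Unset Printing Implicit Defensive.

Import Order.TTheory GRing.Theory Num.Theory.
Import numFieldNormedType.Exports.

Local Open Scope classical_set_scope.
Local Open Scope ring_scope.

#[short(type="finMetricType")]
HB.structure Definition FinMetric (R : numDomainType) :=
  {M of Finite M & Metric R M}.

Section subspace_metric.
Context {R : realType} {Y : metricType R} (A : set Y).

Let dist (x y : A) : R := mdist (\val x) (\val y).

Let dist_ge0 x y : 0 <= dist x y.
Proof. exact: mdist_ge0. Qed.

Let dist_positivity x y : dist x y = 0 -> x = y.
Proof. by move=> /mdist_positivity xy; apply: val_inj. Qed.

Let ballEdist (x : A) (e : R) : ball x e = [set y | dist x y < e].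
Proof.
have -> : ball x e = [set y | ball (\val x) e (\val y)] by [].
by rewrite ballEmdist.
Qed.

HB.instance Definition _ := PseudoMetric_isMetric.Build R (set_type A)
  dist_ge0 dist_positivity ballEdist.

End subspace_metric.

Section Lspace_metric.
Context d (T : measurableType d) (R : realType).
Variables (mu : {measure set T -> \bar R}) (p : \bar R) (p1 : (1 <= p)%E).

(* The elements of LspaceType are classes modulo almost-everywhere equality;
   they coerce to functions through a representative, on which the L^p
   distance does not depend. *)
Let dist (f g : LspaceType mu p1) : R :=
  fine ('N[mu]_p[EFin \o ((f : T -> R) \- (g : T -> R))%R])%E.

Lemma Lspace_rep_Lfun (f : LspaceType mu p1) : (f : T -> R) \in Lfun mu p.
Proof.
rewrite inE; apply/andP; split; rewrite inE/=; last exact: Lebesgue_finite.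
by case: f => f ?; exact: (measurable_funPT (repr f)).
Qed.

Let rep (f : LspaceType mu p1) : LfunType mu p1 :=
  Lfun_Sub p1 (Lspace_rep_Lfun f).

Let distE f g : dist f g = fine ('N[mu]_p[EFin \o (rep f - rep g)%R])%E.
Proof. by []. Qed.

Let distxx f : dist f f = 0.
Proof.
rewrite distE subrr; apply/EFin_inj; rewrite finite_norm_fine.
rewrite (_ : _ \o _ = cst 0%E)// Lnorm0//.
by rewrite gt_eqF// (lt_le_trans _ p1).
Qed.

Let dist_positivity f g : dist f g = 0 -> f = g.
Proof.
rewrite distE => /fine_Lnormr_eq0 fg0.
have fg : (f : {mfun_ mu, T >-> measurableTypeR R}) =
          (g : {mfun_ mu, T >-> measurableTypeR R}).
  rewrite -[LHS]reprK -[RHS]reprK; apply/eqP.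
  rewrite eqmodE; apply/asboolP.
  apply: filterS fg0 => x /= h _; have /= := h I.
  by move=> /eqP; rewrite subr_eq0 => /eqP.
clear fg0; case: f g fg => [f cf] [g cg] /= fg; subst g.
by case: cf cg => [[a]] [[b]]; rewrite (Prop_irrelevance a b).
Qed.

Let dist_sym f g : dist f g = dist g f.
Proof.
rewrite !distE -LnormrN; congr (fine (Lnorm _ _ _)); apply/funext => x /=.
by rewrite !fctE opprB.
Qed.

Let dist_triangle g f h : dist f h <= dist f g + dist g h.
Proof.
rewrite !distE; have -> : rep f - rep h = (rep f - rep g) + (rep g - rep h).
  by rewrite addrA subrK.
exact: ler_LnormD.
Qed.

HB.instance Definition _ := gen_eqMixin (LspaceType mu p1).
HB.instance Definition _ := gen_choiceMixin (LspaceType mu p1).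
HB.instance Definition _ := isMetric.Build R (LspaceType mu p1)
  distxx dist_positivity dist_sym dist_triangle.

End Lspace_metric.

Definition lebesgue01 (R : realType) :
    {measure set measurableTypeR R -> \bar R} :=
  mrestr lebesgue_measure (measurable_itv `[0%R : R, 1%R]).

(* L_1([0, 1]), realized as functions on the line modulo equality almost
   everywhere on [0, 1]. *)
Definition L1 (R : realType) : metricType R := LspaceType1 (lebesgue01 R).

Section distortion.
Context {R : realType}.
Local Open Scope ereal_scope.

(* The supremum is taken in [0, +oo]: it is 0 on a space with at most one
   point. *)
Definition lip_norm (X Y : metricType R) (f : X -> Y) : \bar R :=
  maxe 0 (ereal_sup [set ((mdist (f z.1) (f z.2) / mdist z.1 z.2)%R)%:E
                    | z in [set z : X * X | z.1 != z.2]]).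

(* Inverse of f on its image; the preimage is unique when f is injective. *)
Definition range_inv (X Y : Type) (f : X -> Y) (y : range f) : X :=
  s2val (cid2 (set_mem (valP y))).

Definition distortion (X Y : metricType R) (f : X -> Y) : \bar R :=
  if `[< injective f >] then lip_norm f * lip_norm (@range_inv X Y f)
  else +oo.

Definition min_distortion (Y X : metricType R) : \bar R :=
  ereal_inf (range (@distortion X Y)).

Definition c_1 (X : metricType R) : \bar R := min_distortion (L1 R) X.

End distortion.

(* Main.v *)
Require Import Defs.
From HB Require Import structures.
From mathcomp Require Import all_boot all_order all_algebra.
From mathcomp Require Import all_classical all_reals all_analysis.
From mathcomp Require Import ring lra zify.

(** The spaces are the Cayley graphs of [F_2^k] generated by the rows
    [a_i, i < 8k] of a matrix [A] such that the code [u |-> A u] has minimum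
    distance at least [k]; such an [A] exists by averaging [(1/4)^wt(A u)] over
    all matrices. Since the character attached to [u] satisfies
    [chi_u(a_i) = -1] for exactly [wt(A u)] indices [i], Parseval gives a
    Poincare inequality with constant [k] for 0/1-valued functions, where
    [|a - b| = (a - b)^2]. An inequality which is linear in the pairwise
    distances passes from cuts to real functions (subtract the indicator of the
    support) and from the line to [L_1] (integrate), so the average distance in
    an [L_1] image is at most 4 times the Lipschitz constant. On the other hand
    balls of radius [k/20] contain at most half of the points, so the average
    distance in the graph is of order [k], which is of order [log |X|]. *)

Set Implicit Arguments.
Unset Strict Implicit.
Unset Printing Implicit Defensive.

Import Order.TTheory GRing.Theory Num.Theory.

Local Open Scope ring_scope.


(** * Hamming weight and good linear codes over [F_2], which is [bool] with addition as exclusive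
    or *)

Definition wt m n (v : 'M[bool]_(m, n)) : nat := (\sum_i \sum_j v i j)%N.

Lemma big_bool_expr (R : comNzRingType) (t : R) : \sum_(b : bool) t ^+ b = 1 + t.
Proof. by rewrite big_bool /= expr1 expr0 addrC. Qed.

(** The weight is a sum over entries, so the generating function factors into one factor [1 + t] per
    entry. *)
Lemma sum_expr_wt (R : comNzRingType) (t : R) m n :
  \sum_(v : 'M[bool]_(m, n)) t ^+ wt v = (1 + t) ^+ (m * n).
Proof.
have -> : (m * n)%N = #|{: 'I_m * 'I_n}| by rewrite card_prod !card_ord.
rewrite -prodr_const -(big_bool_expr t) bigA_distr_bigA /=.
rewrite (reindex (fun f : {ffun 'I_m * 'I_n -> bool} => (\matrix_(i, j) f (i, j)))) /=.
  apply: eq_bigr => f _; rewrite /wt pair_bigA /=.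
  by rewrite expr_sum; apply: eq_bigr => -[i j] _; rewrite mxE.
exists (fun v : 'M[bool]_(m, n) => [ffun p => v p.1 p.2]) => [f _|v _].
  by apply/ffunP => -[i j]; rewrite ffunE mxE.
by apply/matrixP => i j; rewrite mxE ffunE.
Qed.

(** For [u != 0] and uniform [A], the vector [A *m u] is uniform; the two averages are compared with
    denominators cleared. Used for the random code and, with one row, for character sums. *)
Lemma sum_mulmx_col (R : comNzRingType) m n (g : 'cV[bool]_m -> R)
    (u : 'cV[bool]_n) :
  u != 0 ->
  2 ^+ m * \sum_(A : 'M[bool]_(m, n)) g (A *m u) =
  #|{: 'M[bool]_(m, n)}|%:R * \sum_v g v.
Proof.
move=> u0.
have [j uj] : exists j, u j 0 = true.
  apply/existsP; apply: contraNT u0 => /existsPn h; apply/eqP/colP => j.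
  by rewrite mxE; have := h j; case: (u j 0).
(* Adding [v] to the [j]-th column of [A] adds [v] to [A *m u]. *)
have shift v : \sum_(A : 'M[bool]_(m, n)) g (A *m u) =
    \sum_(A : 'M[bool]_(m, n)) g (A *m u + v).
  rewrite (reindex_inj (addIr (v *m delta_mx 0 j : 'M[bool]_(m, n)))) /=.
  apply: eq_bigr => A _; congr g; rewrite mulmxDl; congr (_ + _).
  rewrite -mulmxA (_ : _ *m u = 1) ?mulmx1 //.
  by apply/matrixP => a b; rewrite -rowE !ord1 !mxE uj.
have -> : 2 ^+ m = \sum_(v : 'cV[bool]_m) 1 :> R.
  by have := sum_expr_wt (1 : R) m 1; rewrite muln1 => <-;
    apply: eq_bigr => v _; rewrite expr1n.
rewrite mulr_suml; under eq_bigr => v _ do rewrite mul1r (shift v).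
rewrite exchange_big /= -sum1_card natr_sum mulr_suml; apply: eq_bigr => A _.
by rewrite mul1r [RHS](reindex_inj (addrI (A *m u))).
Qed.

Lemma good_code (R : realFieldType) k :
  exists A : 'M[bool]_(8 * k, k),
    forall u : 'cV[bool]_k, u != 0 -> (k <= wt (A *m u)%R)%N.
Proof.
(* By uniformity each nonzero [u] has average [((1 + t) / 2) ^+ (8 * k)], that is
   [(5/8) ^+ (8 * k)]. *)
pose t : R := 4^-1.
have key : \sum_(A : 'M[bool]_(8 * k, k)) \sum_(u : 'cV[bool]_k | u != 0) t ^+ wt (A *m u)
    <= #|{: 'M[bool]_(8 * k, k)}|%:R * t ^+ k.
  set N : R := #|_|%:R.
  rewrite exchange_big /=.
  have each (u : 'cV[bool]_k) : u != 0 ->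
    \sum_(A : 'M[bool]_(8 * k, k)) t ^+ wt (A *m u) = N * ((5 / 8) ^+ 8) ^+ k.
    move=> u0; have /= := @sum_mulmx_col R (8 * k) k (fun v => t ^+ wt v) u u0.
    rewrite sum_expr_wt muln1 -/N => h.
    apply: (@mulfI _ (2 ^+ (8 * k))); first by rewrite expf_neq0 // pnatr_eq0.
    rewrite h mulrCA; congr (_ * _); rewrite -exprM -exprMn; congr (_ ^+ _).
    by rewrite /t; field.
  rewrite (eq_bigr _ each) sumr_const -[leLHS]mulr_natl mulrCA ler_wpM2l ?ler0n //.
  have cardk : (#|[pred u : 'cV[bool]_k | u != 0]|%:R : R) <= 2 ^+ k.
    apply: le_trans (_ : (#|{: 'cV[bool]_k}|%:R : R) <= _).
      by rewrite ler_nat max_card.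
    by rewrite card_mx card_bool muln1 natrX.
  apply: le_trans (ler_wpM2r _ cardk) _; first by rewrite !exprn_ge0 // divr_ge0 ?ler0n.
  (* With fewer than [2 ^+ k] vectors [u], it remains to see that [2 * (5/8) ^+ 8 <= 1/4]. *)
  rewrite -exprMn; apply: lerXn2r; rewrite ?nnegrE /t.
  - lra.
  - lra.
  - lra.
have [A hA] : exists A : 'M[bool]_(8 * k, k),
    \sum_(u : 'cV[bool]_k | u != 0) t ^+ wt (A *m u) <= t ^+ k.
  apply/existsP; apply: contraLR key => /existsPn h; rewrite -ltNge.
  rewrite mulr_natl -sumr_const; apply: ltr_sum => [|A _]; last by rewrite ltNge; exact: h.
  by apply/hasP; exists 0; rewrite ?mem_index_enum.
exists A => u u0.
(* A single nonnegative term is at most the whole sum; as [t < 1], the exponents compare in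
   reverse. *)
have : t ^+ wt (A *m u) <= t ^+ k.
  apply: le_trans hA; rewrite (bigD1 u) //= lerDl sumr_ge0 // => v _.
  by rewrite exprn_ge0 // /t invr_ge0.
by rewrite ler_iXn2l // /t; lra.
Qed.


(** * Fourier analysis on [F_2^k] and the Poincare inequality for squares *)

Section Fourier.
Variables (R : numFieldType) (k : nat).
Implicit Types (x y a : 'rV[bool]_k) (u : 'cV[bool]_k) (f : 'rV[bool]_k -> R).

Definition chi u x : R := (-1) ^+ ((x *m u) 0 0 : bool).

Lemma chiD u x y : chi u (x + y) = chi u x * chi u y.
Proof. by rewrite /chi mulmxDl mxE signr_addb. Qed.

Lemma sum_chi_dom u : u != 0 -> \sum_x chi u x = 0.
Proof.
move=> u0; apply: (@mulfI _ (2 ^+ 1)); first by rewrite expf_neq0 // pnatr_eq0.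
have /= -> := @sum_mulmx_col R 1 k (fun v => (-1) ^+ (v 0 0 : bool)) u u0.
rewrite mulr0 (eq_bigr (fun v : 'cV[bool]_1 => (-1) ^+ wt v)).
  by rewrite sum_expr_wt subrr expr1 mulr0.
by move=> v _; rewrite /wt !big_ord1.
Qed.

(** The dual orthogonality relation follows by transposition, since the pairing of [x] and [u] is
    symmetric. *)
Lemma sum_chi_char x : \sum_u chi u x = 2 ^+ k *+ (x == 0).
Proof.
have [->|x0] := eqVneq x 0.
  rewrite (eq_bigr (fun=> 1)) => [|u _]; last by rewrite /chi mul0mx mxE.
  by rewrite sumr_const card_mx card_bool muln1 natrX.
rewrite mulr0n; apply: etrans (@sum_chi_dom x^T _).
  rewrite (reindex (@trmx bool 1 k)) /=.
    by apply: eq_bigr => y _; rewrite /chi -[x in LHS]trmxK -trmx_mul mxE.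
  by exists (@trmx bool k 1) => y _; rewrite trmxK.
by apply: contra x0 => /eqP h; rewrite -(trmxK x) h trmx0.
Qed.

Definition fourier f u := \sum_x f x * chi u x.

Lemma mxbool_addxx m n (v : 'M[bool]_(m, n)) : v + v = 0.
Proof. by apply/matrixP => i j; rewrite !mxE; case: (v i j). Qed.

Lemma mxbool_opp m n (v : 'M[bool]_(m, n)) : - v = v.
Proof. by apply/matrixP => i j; rewrite mxE. Qed.

(** Expand the square and sum over [u] first: only [x + y = 0] survives, which means [x = y] in
    characteristic 2. The factor [2 ^+ k] appears because [fourier] is unnormalised. *)
Lemma parseval f : \sum_u fourier f u ^+ 2 = 2 ^+ k * \sum_x f x ^+ 2.
Proof.
transitivity (\sum_x \sum_y f x * f y * \sum_u chi u (x + y)).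
  under [RHS]eq_bigr => x _ do under eq_bigr => y _ do rewrite mulr_sumr.
  under [RHS]eq_bigr => x _ do rewrite exchange_big.
  rewrite [RHS]exchange_big /=; apply: eq_bigr => u _.
  rewrite expr2 /fourier mulr_suml; apply: eq_bigr => x _.
  rewrite mulr_sumr; apply: eq_bigr => y _.
  by rewrite chiD mulrACA.
rewrite mulr_sumr; apply: eq_bigr => x _.
rewrite (bigD1 x) //= [X in _ + X]big1 => [|y yx].
  by rewrite addr0 sum_chi_char mxbool_addxx eqxx mulr1n mulrC expr2.
by rewrite sum_chi_char -[y in x + y]mxbool_opp subr_eq0 eq_sym (negPf yx) mulr0.
Qed.

Lemma fourier_translate f a u :
  fourier (fun x => f (x + a)) u = chi u a * fourier f u.
Proof.
rewrite /fourier [in RHS](reindex_inj (addIr a)) /= mulr_sumr.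
apply: eq_bigr => x _; rewrite chiD mulrCA; congr (_ * _).
by rewrite mulrCA -expr2 sqrr_sign mulr1.
Qed.

(** Taking increments along [g i] multiplies the coefficient at [u] by [1 - chi u (g i)], whose
    square is 4 or 0 according to the bit [g i *m u]. It is applied both to the rows of [A] and to
    all of [F_2^k]. *)
Lemma sum_sqr_increments (I : finType) (g : I -> 'rV[bool]_k) f :
  2 ^+ k * (\sum_i \sum_x (f x - f (x + g i)) ^+ 2) =
  \sum_u 4 * (\sum_i ((g i *m u) 0 0)%R)%N%:R * fourier f u ^+ 2.
Proof.
rewrite mulr_sumr; under eq_bigr => i _ do
  rewrite -(parseval (fun x => f x - f (x + g i))).
rewrite exchange_big; apply: eq_bigr => u _ /=.
rewrite natr_sum mulr_sumr mulr_suml; apply: eq_bigr => i _.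
have -> : fourier (fun x => f x - f (x + g i)) u = (1 - chi u (g i)) * fourier f u.
  rewrite mulrBl mul1r -fourier_translate /fourier -sumrB.
  by apply: eq_bigr => x _; rewrite mulrBl.
rewrite exprMn; congr (_ * _); rewrite /chi.
by case: (_ 0 0); rewrite /= ?expr1 ?expr0; ring.
Qed.

Lemma sum_mulmx_bool u : u != 0 ->
  2 * (\sum_(x : 'rV[bool]_k) ((x *m u) 0 0)%R)%N%:R = 2 ^+ k :> R.
Proof.
move=> u0; apply/esym/eqP; rewrite -subr_eq0; apply/eqP.
apply: etrans (sum_chi_dom u0).
have -> : 2 ^+ k = \sum_(x : 'rV[bool]_k) 1 :> R.
  by rewrite sumr_const card_mx card_bool mul1n natrX.
rewrite natr_sum mulr_sumr -sumrB; apply: eq_bigr => x _.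
by rewrite /chi; case: (_ 0 0); rewrite /= ?expr1 ?expr0; ring.
Qed.

Lemma wt_mulmx_row n (A : 'M[bool]_(n, k)) u :
  wt (A *m u) = (\sum_i ((row i A *m u) 0 0)%R)%N.
Proof. by apply: eq_bigr => i _; rewrite big_ord1 -row_mul [in RHS]mxE.
Qed.

(** Both sides are diagonal in the Fourier basis. After scaling by [2 ^+ k], the coefficients at
    [u != 0] are [4 * m * 2 ^+ k] and [4 * wt (A *m u) * 2 ^+ k]; at [u = 0] the left one
    vanishes. *)
Lemma poincare_sqr n (A : 'M[bool]_(n, k)) m f :
  (forall u, u != 0 -> (m <= wt (A *m u)%R)%N) ->
  (forall x, f x \is Num.real) ->
  2 * m%:R * (\sum_x \sum_y (f x - f y) ^+ 2) <=
  2 ^+ k * (\sum_i \sum_x (f x - f (x + row i A)) ^+ 2).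
Proof.
move=> Am fr; rewrite (sum_sqr_increments (fun i => row i A)).
(* All pairs are the increments along all group elements, so [sum_sqr_increments] applies with
   [id]. *)
have -> : \sum_x \sum_y (f x - f y) ^+ 2 = \sum_a \sum_x (f x - f (x + a)) ^+ 2.
  rewrite exchange_big /=; apply: esym.
  rewrite exchange_big /= [RHS]exchange_big; apply: eq_bigr => x _.
  by rewrite [RHS](reindex_inj (addrI x)).
rewrite -(ler_pM2l (exprn_gt0 k (ltr0n _ 2))) mulrCA (sum_sqr_increments id).
rewrite !mulr_sumr; apply: ler_sum => u _.
have F2 v : 0 <= fourier f v ^+ 2.
  rewrite real_exprn_even_ge0 // /fourier rpred_sum // => x _.
  by rewrite rpredM // rpredX // rpredN rpred1.
have [->|u0] := eqVneq u 0.
  under eq_bigr => x _ do rewrite mulmx0 mxE.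
  rewrite big1 // mulr0 mul0r mulr0 mulr_ge0 ?exprn_ge0 //.
  by rewrite mulr_ge0 ?F2 // mulr_ge0 ?ler0n.
move: (_ ^+ 2) (F2 u) => Q Q0; rewrite -wt_mulmx_row !mulrA ler_wpM2r //.
have -> : 2 * m%:R * 4 * (\sum_(x : 'rV[bool]_k) ((x *m u) 0 0)%R)%N%:R =
    4 * m%:R * 2 ^+ k :> R.
  by rewrite -(sum_mulmx_bool u0); ring.
rewrite [leRHS]mulrC mulrA [leRHS]mulrAC ler_wpM2r ?exprn_ge0 //.
by rewrite [leRHS]mulrC ler_wpM2l ?ler0n // ler_nat Am.
Qed.

End Fourier.

(** * From cuts to the line and to [L_1] *)

(** A shift by a constant makes [g] nonnegative without changing differences; then induct on a bound
    [n] for the size of the support. *)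
Lemma cut_cone (R : realDomainType) (T : finType) (w : T -> T -> R) :
  (forall h : T -> bool, 0 <= \sum_x \sum_y w x y * `|(h x)%:R - (h y)%:R|) ->
  forall g : T -> R, 0 <= \sum_x \sum_y w x y * `|g x - g y|.
Proof.
move=> wcut g.
have [c gc] : exists c, forall x, c <= g x.
  exists (- \sum_x `|g x|) => x; rewrite lerNl (bigD1 x) //=.
  by rewrite -normrN ler_wpDr ?ler_norm ?sumr_ge0.
suff pos (g' : T -> R) : (forall x, 0 <= g' x) ->
    0 <= \sum_x \sum_y w x y * `|g' x - g' y|.
  have := pos (fun x => g x - c);
    rewrite (eq_bigr (fun x => \sum_y w x y * `|g x - g y|)).
    by apply=> x; rewrite subr_ge0.
  by move=> x _; apply: eq_bigr => y _; rewrite opprB addrA subrK.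
move=> {c gc}; move: {2}(#|_|) (leqnn #|[pred x | 0 < g' x]|) => n.
elim: n g' => [|n IH] {}g gn g0.
  rewrite big1 // => x _; rewrite big1 // => y _.
  move: gn; rewrite leqn0 => /eqP/card0_eq gn.
  have g_0 z : g z = 0.
    by have := gn z; rewrite inE lt_def g0 andbT => /negbFE/eqP.
  by rewrite !g_0 subrr normr0 mulr0.
have [x0 gx0|no] := pickP [pred x | 0 < g x]; last first.
  by apply: IH => //; rewrite (eq_card0 no).
case: (arg_minP g gx0) => z /= gz zmin.
pose h x := 0 < g x.
have hg x : h x = false -> g x = 0.
  by rewrite /h lt_def g0 andbT => /negbFE/eqP.
(* Subtracting the least positive value of [g] on its support shrinks the
   support and splits off a multiple of a cut. *)
have split_abs x y : `|g x - g y| = g z * `|(h x)%:R - (h y)%:R|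
    + `|(g x - g z * (h x)%:R) - (g y - g z * (h y)%:R)|.
  case hx: (h x); case hy: (h y); rewrite ?(hg _ hx) ?(hg _ hy) /= ?mulr0
    ?mulr1 ?subr0 ?sub0r ?subrr ?normr0 ?mulr0 ?add0r ?addr0 ?normrN ?normr1
    ?mulr1.
  - by congr `|_|; rewrite opprB addrA subrK.
  - have := zmin _ hx; move=> h1; rewrite !ger0_norm ?subr_ge0 // ?g0 //.
    by rewrite addrC subrK.
  - have := zmin _ hy; move=> h1; rewrite !ger0_norm ?subr_ge0 // ?g0 //.
    by rewrite addrC subrK.
  - by [].
under eq_bigr => x _ do under eq_bigr => y _ do rewrite split_abs mulrDr.
under eq_bigr => x _ do rewrite big_split.
rewrite big_split /= addr_ge0 //.
  apply: le_trans (mulr_ge0 (g0 z) (wcut h)) _;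
    rewrite le_eqVlt; apply/orP; left; apply/eqP.
  rewrite mulr_sumr; apply: eq_bigr => x _; rewrite mulr_sumr.
  by apply: eq_bigr => y _; rewrite mulrCA.
apply: IH => [|x].
  rewrite -ltnS; apply: leq_trans gn; apply: proper_card; apply/properP; split.
    apply/fintype.subsetP => x; rewrite !inE; case hx: (h x);
      first by move=> _; exact: hx.
    by rewrite (hg _ hx) mulr0 subr0 ltxx.
  by exists z; rewrite !inE // /h gz mulr1 subrr ltxx.
by case hx: (h x); rewrite ?mulr0 ?subr0 // mulr1 subr_ge0 zmin.
Qed.

Lemma Rintegral_sum d (T : measurableType d) (R : realType)
    (mu : {measure set T -> \bar R}) (I : Type) (r : seq I) (w : I -> R)
    (h : I -> T -> R) :
  (forall i, mu.-integrable setT (EFin \o h i)) ->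
  \sum_(i <- r) w i * Rintegral mu setT (h i) =
  Rintegral mu setT (fun t => \sum_(i <- r) w i * h i t).
Proof.
move=> ih.
have iwh i : mu.-integrable setT (EFin \o (fun t => w i * h i t)).
  rewrite (_ : _ \o _ = (fun t => (w i)%:E * (EFin \o h i) t)%E) //.
  exact: integrableZl.
elim: r => [|i r IH].
  under [RHS]eq_Rintegral do rewrite big_nil.
  by rewrite big_nil Rintegral_cst // mul0r.
under [RHS]eq_Rintegral do rewrite big_cons.
rewrite big_cons RintegralD //; first by rewrite IH RintegralZl.
rewrite (_ : _ \o _ = (fun t => \sum_(j <- r) (EFin \o (fun t => (w j * h j t)%R)) t)%E).
  by apply: integrable_sum => // j _; exact: iwh.
by apply/funext => t /=; rewrite sumEFin.
Qed.

Lemma mdist_L1E (R : realType) (f g : L1 R) :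
  mdist f g = Rintegral (lebesgue01 R) setT (fun t => `|f t - g t|).
Proof. by rewrite /mdist /= Lnorm1. Qed.

Lemma integrable_L1_dist (R : realType) (f g : L1 R) :
  (lebesgue01 R).-integrable setT (EFin \o (fun t => `|f t - g t|)).
Proof.
have iL (e : L1 R) : (lebesgue01 R).-integrable setT (EFin \o (e : _ -> R)).
  by apply/Lfun1_integrable; exact: Lspace_rep_Lfun.
apply: (@integrable_norm _ _ _ _ _ (fun t => f t - g t)).
rewrite (_ : _ \o _ = (EFin \o (f : _ -> R)) \- (EFin \o (g : _ -> R)))%E //.
exact: integrableB.
Qed.

(** The weighted sum is the integral over [t] of the same sum for the real values [f x t]. The
    representatives are fixed, so [cut_cone] applies at every [t], with no exceptional null set. *)
Lemma cut_cone_L1 (R : realType) (T : finType) (w : T -> T -> R) :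
  (forall h : T -> bool, 0 <= \sum_x \sum_y w x y * `|(h x)%:R - (h y)%:R|) ->
  forall f : T -> L1 R, 0 <= \sum_x \sum_y w x y * mdist (f x) (f y).
Proof.
move=> wcut f; rewrite pair_bigA /=.
under eq_bigr => p _ do rewrite mdist_L1E.
rewrite (@Rintegral_sum _ _ _ _ _ _ (fun p : T * T => w p.1 p.2)
  (fun p t => `|f p.1 t - f p.2 t|)); last first.
  by move=> p; exact: integrable_L1_dist.
apply: Rintegral_ge0 => t _.
rewrite -(pair_bigA _ (fun x y => w x y * `|f x t - f y t|)).
exact: (cut_cone wcut (fun x => f x t)).
Qed.

Lemma poincare_L1 (R : realType) n k (A : 'M[bool]_(n, k)) m
    (f : 'rV[bool]_k -> L1 R) :
  (forall u : 'cV[bool]_k, u != 0 -> (m <= wt (A *m u)%R)%N) ->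
  2 * m%:R * (\sum_x \sum_y mdist (f x) (f y)) <=
  2 ^+ k * (\sum_i \sum_x mdist (f x) (f (x + row i A))).
Proof.
move=> Am.
(* These weights encode right side minus left side; the inner sum counts edges with multiplicity,
   since rows of [A] may coincide. *)
pose w (x y : 'rV[bool]_k) : R :=
  2 ^+ k * (\sum_i (y == x + row i A)%:R) - 2 * m%:R.
have wE (D : 'rV[bool]_k -> 'rV[bool]_k -> R) : \sum_x \sum_y w x y * D x y =
    2 ^+ k * (\sum_i \sum_x D x (x + row i A)) - 2 * m%:R * (\sum_x \sum_y D x y).
  rewrite [in RHS]exchange_big /= 2!mulr_sumr -sumrB; apply: eq_bigr => x _.
  under eq_bigr => y _ do rewrite /w mulrBl -[X in X - _]mulrA.
  rewrite sumrB -!mulr_sumr; congr (_ * _ - _).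
  transitivity (\sum_y \sum_i (y == x + row i A)%:R * D x y).
    by apply: eq_bigr => y _; rewrite -mulr_suml.
  rewrite exchange_big; apply: eq_bigr => i _ /=.
  rewrite (bigD1 (x + row i A)) //= eqxx mul1r big1 ?addr0 // => y /negPf ->.
  by rewrite mul0r.
rewrite -subr_ge0 -(wE (fun x y => mdist (f x) (f y))).
apply: cut_cone_L1 => h; rewrite (wE (fun x y => `|(h x)%:R - (h y)%:R|)) subr_ge0.
(* On cuts absolute values equal squares, so [poincare_sqr] gives the cut inequality. *)
have sqr (a b : bool) : `|a%:R - b%:R| = (a%:R - b%:R) ^+ 2 :> R.
  by case: a; case: b; rewrite ?subrr ?subr0 ?sub0r ?normrN
     ?normr0 ?normr1 ?sqrrN ?expr1n ?expr0n.
have := @poincare_sqr R k n A m (fun x => (h x)%:R) Am (fun=> num_real _).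
under eq_bigr => x _ do under eq_bigr => y _ do rewrite -sqr.
by under [X in _ <= _ * X]eq_bigr => x _ do under eq_bigr => y _ do rewrite -sqr.
Qed.

(** * Word length for the generators [row i A] and the size of its balls *)

Section word_length.
Variables (n k : nat) (A : 'M[bool]_(n, k)).

(* Elements outside the row space of [A] get length [n.+1], more than that of
   any word. *)
Definition wlen (x : 'rV[bool]_k) : nat :=
  \big[Order.min/n.+1]_(s : 'rV[bool]_n | s *m A == x) wt s.

Lemma wt_row_le (s : 'rV[bool]_n) : (wt s <= n)%N.
Proof.
rewrite /wt big_ord1 -[X in (_ <= X)%N]card_ord -sum1_card.
by apply: leq_sum => i _; exact: leq_b1.
Qed.

Lemma wtD p q (s t : 'M[bool]_(p, q)) : (wt (s + t)%R <= wt s + wt t)%N.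
Proof.
rewrite /wt -big_split; apply: leq_sum => i _; rewrite -big_split.
by apply: leq_sum => j _; rewrite mxE; case: (s i j); case: (t i j).
Qed.

Lemma wt_eq0 p q (s : 'M[bool]_(p, q)) : (wt s == 0%N) = (s == 0).
Proof.
rewrite /wt sum_nat_eq0; apply/idP/eqP => [/forallP h|->].
  apply/matrixP => i j; have := h i; rewrite sum_nat_eq0 => /forallP/(_ j).
  by rewrite mxE; case: (s i j).
by apply/forallP => i; rewrite sum_nat_eq0; apply/forallP => j; rewrite mxE.
Qed.

Lemma wlen_le s : (wlen (s *m A) <= wt s)%N.
Proof. by rewrite -leEnat; apply: bigmin_le_cond; rewrite eqxx. Qed.

Lemma wlenP x : (exists2 s, s *m A = x & wlen x = wt s) \/ wlen x = n.+1.
Proof.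
rewrite /wlen; elim/big_ind : _ => [|a b ha hb|s /eqP sx]; first by right.
  by rewrite /Order.min; case: ifP.
by left; exists s.
Qed.

Lemma wlen_leS x : (wlen x <= n.+1)%N.
Proof. by case: (wlenP x) => [[s _ ->]|-> //]; rewrite leqW // wt_row_le. Qed.

Lemma wlenD x y : (wlen (x + y)%R <= wlen x + wlen y)%N.
Proof.
(* If a summand has the default length [n.+1], the bound holds because no length exceeds [n.+1]. *)
have [[s <- ->]|->] := wlenP x; last by rewrite (leq_trans (wlen_leS _)) ?leq_addr.
have [[t <- ->]|->] := wlenP y; last by rewrite (leq_trans (wlen_leS _)) ?leq_addl.
by rewrite -mulmxDl (leq_trans (wlen_le _)) ?wtD.
Qed.

Lemma wlen_eq0 x : (wlen x == 0%N) = (x == 0).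
Proof.
apply/eqP/eqP => [x0|->]; last first.
  by apply/eqP; rewrite -leqn0 -(mul0mx _ A) (leq_trans (wlen_le _)) ?leqn0 ?wt_eq0.
have [[s sx ws]|] := wlenP x; last by rewrite x0.
by move: ws; rewrite x0 -sx => /esym/eqP; rewrite wt_eq0 => /eqP ->; rewrite mul0mx.
Qed.

Lemma wlen_row i : (wlen (row i A) <= 1)%N.
Proof.
rewrite rowE (leq_trans (wlen_le _)) // /wt big_ord1 (bigD1 i) //= big1 => [|j ji].
  by rewrite addn0 leq_b1.
by rewrite mxE (negPf ji).
Qed.

(** Words of weight below [j] reach at most half of the group, and each remaining element
    contributes at least [j]. *)
Lemma sum_wlen_ge (R : realFieldType) j :
  k = (20 * j)%N -> n = (8 * k)%N -> (0 < j)%N ->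
  2 ^+ k * j%:R <= 2 * (\sum_x wlen x)%N%:R :> R.
Proof.
move=> kj nk j0.
pose S := [set x | (wlen x < j)%N]%SET.
pose B := [set s : 'rV[bool]_n | (wt s < j)%N]%SET.
have SB : (#|S| <= #|B|)%N.
  apply: leq_trans (leq_imset_card (fun s => s *m A) (mem B)).
  apply/subset_leq_card/fintype.subsetP => x; rewrite inE => xj.
  have [[s sx ws]|wx] := wlenP x.
    by apply/imsetP; exists s; rewrite // inE -ws.
  (* The default length [n.+1] is above [j], as [n = 160 * j]. *)
  by exfalso; move: xj; rewrite wx; lia.
(* The ball is bounded by [t^-j] times the generating function of the weights. *)
pose t : R := 1 / 20.
have t0 : 0 < t by rewrite /t; lra.
have t1 : t < 1 by rewrite /t; lra.
(* Since [n = 160 * j], this bounds the ball by [2 ^+ (19 * j)]; the power is taken in two stages,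
   rounding up to [2 + 1/5] after the first. *)
have num : (1 + t) ^+ 160 <= 2 ^+ 19 * t.
  have p16 : (1 + t) ^+ 16 <= 2 + 1 / 5.
    by rewrite /t; lra.
  rewrite (_ : 160 = 16 * 10)%N // exprM.
  apply: le_trans (_ : (2 + 1 / 5) ^+ 10 <= _).
    by apply: lerXn2r; rewrite ?nnegrE ?exprn_ge0 //; lra.
  by rewrite /t; lra.
have cardB : #|B|%:R * t ^+ j <= (1 + t) ^+ n.
  have := sum_expr_wt t 1 n; rewrite mul1n => <-.
  rewrite mulr_natl -sumr_const big_mkcond /= ler_sum // => s _.
  rewrite inE; case: ifP => [sj|_]; last by rewrite exprn_ge0 // ltW.
  by rewrite ler_wiXn2l ?ltW // ltnW.
have cardB2 : 2 * #|B|%:R <= 2 ^+ k :> R.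
  have tj : 0 < t ^+ j by rewrite exprn_gt0.
  rewrite -(ler_pM2r tj) -mulrA.
  apply: le_trans (_ : 2 * (1 + t) ^+ n <= _); first by rewrite ler_pM2l.
  rewrite nk kj !mulnA exprM.
  apply: le_trans (_ : 2 * (2 ^+ 19 * t) ^+ j <= _).
    rewrite ler_pM2l // lerXn2r ?nnegrE ?exprn_ge0 ?mulr_ge0 //; lra.
  rewrite exprMn mulrA; apply: ler_wpM2r; first exact: ltW.
  (* The extra factor 2 fits between [2 ^+ (19 * j)] and [2 ^+ (20 * j)] because [0 < j]. *)
  by rewrite -exprM -exprS ler_weXn2l ?ler1n //; lia.
have cardSC : #|S|%:R + #|~: S|%:R = 2 ^+ k :> R.
  by rewrite -natrD cardsC card_mx card_bool mul1n natrX.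
have sumj : #|~: S|%:R * j%:R <= (\sum_x wlen x)%N%:R :> R.
  rewrite -natrM ler_nat -sum_nat_const big_mkcond /= leq_sum // => x _.
  by rewrite !inE; case: ifP => //; rewrite -leqNgt.
have SB' : #|S|%:R <= #|B|%:R :> R by rewrite ler_nat.
have j0' : 0 <= j%:R :> R by [].
apply: le_trans (_ : 2 * (#|~: S|%:R * j%:R) <= _); last by rewrite ler_pM2l.
by rewrite mulrA ler_wpM2r //; lra.
Qed.

End word_length.

(** * The Cayley graph as a finite metric space *)

(* The parameters [R] and [A] are phantoms that make the metric inferable. *)
Definition cayley (R : realType) n k (A : 'M[bool]_(n, k)) : Type := 'rV[bool]_k.

Section cayley_metric.
Variables (R : realType) (n k : nat) (A : 'M[bool]_(n, k)).

HB.instance Definition _ := Finite.copy (cayley R A) 'rV[bool]_k.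

Let dist (x y : cayley R A) : R :=
  (wlen A ((x : 'rV[bool]_k) + (y : 'rV[bool]_k)))%:R.

Let distxx x : dist x x = 0.
Proof. by apply/eqP; rewrite pnatr_eq0 wlen_eq0 mxbool_addxx. Qed.

Let dist_positivity x y : dist x y = 0 -> x = y.
Proof.
move/eqP; rewrite pnatr_eq0 wlen_eq0 -[y in _ + y]mxbool_opp subr_eq0.
by move/eqP.
Qed.

Let dist_sym x y : dist x y = dist y x.
Proof. by rewrite /dist addrC. Qed.

Let dist_triangle y x z : dist x z <= dist x y + dist y z.
Proof.
rewrite /dist -natrD ler_nat; apply: leq_trans (wlenD _ _ _).
by rewrite -addrA (addrA (y : 'rV[bool]_k)) mxbool_addxx add0r.
Qed.

HB.instance Definition _ := isMetric.Build R (cayley R A)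
  distxx dist_positivity dist_sym dist_triangle.

Lemma mdist_cayleyE (x y : cayley R A) :
  mdist x y = (wlen A ((x : 'rV[bool]_k) + (y : 'rV[bool]_k)))%:R.
Proof. by []. Qed.

End cayley_metric.

(** * Bounding distortion from below *)

Lemma lip_norm_le (R : realType) (X Y : metricType R) (f : X -> Y) (L : R) x y :
  (lip_norm f <= L%:E)%E -> mdist (f x) (f y) <= L * mdist x y.
Proof.
move=> fL; have [->|xy] := eqVneq x y; first by rewrite !mdistxx mulr0.
have d0 : 0 < mdist x y by rewrite mdist_gt0.
rewrite -ler_pdivrMr // -lee_fin; apply: le_trans fL.
by rewrite /lip_norm le_max ereal_sup_ubound ?orbT //; exists (x, y).
Qed.

Lemma lip_norm_gt0 (R : realType) (X Y : metricType R) (f : X -> Y) x y :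
  x != y -> f x != f y -> (0 < lip_norm f)%E.
Proof.
move=> xy fxy; rewrite /lip_norm lt_max; apply/orP; right.
apply: (@lt_le_trans _ _ (mdist (f x) (f y) / mdist x y)%:E).
  by rewrite lte_fin divr_gt0 ?mdist_gt0.
by apply: ereal_sup_ubound; exists (x, y).
Qed.

(** Reduces to finite Lipschitz constants. The distinct points [x0], [x1] make both Lipschitz norms
    positive when [f] is injective, so an infinite factor makes the product [+oo] instead of
    [0 * +oo = 0]. *)
Lemma distortion_ge (R : realType) (X Y : metricType R) (f : X -> Y)
    (K : R) (x0 x1 : X) :
  x0 != x1 ->
  (forall L M : R, 0 <= L -> 0 <= M ->
    (forall x y, mdist (f x) (f y) <= L * mdist x y) ->
    (forall x y, mdist x y <= M * mdist (f x) (f y)) -> K <= L * M) ->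
  (K%:E <= distortion f)%E.
Proof.
move=> x01 h; rewrite /distortion; case: asboolP => [finj|_]; last by rewrite leey.
pose F x : range f := SigSub (mem_set (ex_intro2 _ _ x I erefl : range f (f x))).
have FK x : range_inv (F x) = x.
  by rewrite /range_inv; case: cid2 => z _ /= /finj.
have f01 : f x0 != f x1 by apply: contra x01 => /eqP/finj ->.
have lf : (0 < lip_norm f)%E by apply: lip_norm_gt0 x01 f01.
have lg : (0 < lip_norm (@range_inv X Y f))%E.
  apply: (@lip_norm_gt0 _ _ _ _ (F x0) (F x1)); last by rewrite !FK.
  by apply: contra f01 => /eqP/(congr1 val)/= ->.
case ef : (lip_norm f) lf => [L| |] // lf; last by rewrite gt0_mulye ?leey.
case eg : (lip_norm (@range_inv X Y f)) lg => [M| |] // lg; last by rewrite gt0_muley ?leey.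
rewrite -EFinM lee_fin; apply: h.
- by rewrite -lee_fin ltW.
- by rewrite -lee_fin ltW.
- by move=> x y; apply: lip_norm_le; rewrite ef.
- move=> x y; rewrite -{1}(FK x) -{1}(FK y).
  have := @lip_norm_le _ _ _ (@range_inv X Y f) M (F x) (F y).
  by rewrite eg lexx => /(_ isT).
Qed.

(** * Logarithmic lower bound for the Cayley graphs of good codes *)

Theorem corollary3p5 (R : realType) :
  exists2 c : R, 0 < c &
    forall N : nat, exists X : finMetricType R,
      (N <= #|X|)%N /\ ((c * ln #|X|%:R)%:E <= c_1 X)%E.
Proof.
(* The proof gives [j / 8 <= L * M], while [ln #|X| = 20 * j * ln 2 <= 20 * j]. *)
exists (160^-1) => [|N]; first by rewrite invr_gt0.
pose j := N.+1; pose k := (20 * j)%N.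
have [A hA] := good_code R k.
exists (cayley R A : finMetricType R).
have cardX : #|(cayley R A : finMetricType R)| = (2 ^ k)%N.
  by rewrite card_mx card_bool mul1n.
rewrite cardX; split.
  by rewrite (leq_trans _ (ltnW (ltn_expl k (ltnSn 1)))) // /k /j; lia.
have lnk : 160^-1 * ln (2 ^ k)%:R <= j%:R / 8 :> R.
  rewrite natrX lnXn // -[ln 2 *+ _]mulr_natl.
  have ln2 : ln 2 <= 1 :> R.
    by rewrite (_ : 2 = 1 + 1 :> R) ?le_ln1Dx //; lra.
  rewrite (_ : _ * _ = j%:R / 8 * ln 2).
    by rewrite ler_piMr.
  by rewrite /k natrM; field.
apply: le_ereal_inf_tmp => _ [f _ <-].
apply: (@distortion_ge _ _ _ f _ (0 : 'rV[bool]_k) (const_mx true : 'rV[bool]_k)).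
  by apply/eqP => /rowP/(_ (Ordinal (isT : 0 < k)%N)); rewrite !mxE.
move=> L M L0 M0 fL fM; apply: le_trans lnk _.
pose W : R := (\sum_x wlen A x)%N%:R.
have k0 : 0 < k%:R :> R by rewrite ltr0n.
have p0 : 0 < 2 ^+ k :> R by rewrite exprn_gt0.
have sum1 : \sum_(x : 'rV[bool]_k) 1 = 2 ^+ k :> R.
  by rewrite sumr_const card_mx card_bool mul1n natrX.
have Wj : 2 ^+ k * j%:R <= 2 * W by apply: (@sum_wlen_ge _ _ A R j).
(* By translation invariance every row of the distance matrix sums to [W]. *)
have sumd : \sum_(x : 'rV[bool]_k) \sum_(y : 'rV[bool]_k)
    mdist (x : cayley R A) (y : cayley R A) = 2 ^+ k * W.
  rewrite -sum1 mulr_suml; apply: eq_bigr => x _.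
  rewrite mul1r /W natr_sum (reindex_inj (addrI x)) /=.
  by apply: eq_bigr => y _; rewrite mdist_cayleyE addrA mxbool_addxx add0r.
have P := @poincare_L1 R _ _ A k f hA.
(* Each edge has length at most 1, so its image has length at most [L]. *)
have up : \sum_(i < 8 * k) \sum_(x : 'rV[bool]_k) mdist (f x) (f (x + row i A))
    <= (8 * k)%:R * (2 ^+ k * L).
  rewrite -[X in X%:R * _]card_ord mulr_natl -sumr_const; apply: ler_sum => i _.
  rewrite -sum1 mulr_suml; apply: ler_sum => x _; rewrite mul1r.
  apply: le_trans (fL _ _) _; rewrite ler_piMr // mdist_cayleyE.
  by rewrite addrA mxbool_addxx add0r lern1 wlen_row.
have low : 2 ^+ k * W <=
    M * \sum_(x : 'rV[bool]_k) \sum_(y : 'rV[bool]_k) mdist (f x) (f y).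
  rewrite -sumd mulr_sumr; apply: ler_sum => x _; rewrite mulr_sumr.
  by apply: ler_sum => y _; exact: fM.
have {P up} P := le_trans P (ler_wpM2l (ltW p0) up).
move: (\sum_x \sum_y _) P low => S P low.
(* Poincare bounds the sum of image distances above, co-Lipschitzness bounds it below; the factor
   [k] then cancels. *)
have {}low : 2 * k%:R * (2 ^+ k * W) <= M * (2 ^+ k * ((8 * k)%:R * (2 ^+ k * L))).
  apply: le_trans (ler_wpM2l _ low) _; first by rewrite mulr_ge0 ?ler0n.
  by rewrite mulrCA ler_wpM2l.
have {}low : W <= 4 * 2 ^+ k * (L * M).
  have q0 : 0 < 2 * k%:R * 2 ^+ k :> R by rewrite !mulr_gt0.
  rewrite -(ler_pM2l q0) -[leLHS]mulrA; apply: le_trans low _.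
  by rewrite natrM le_eqVlt; apply/orP; left; apply/eqP; ring.
rewrite ler_pdivrMr // -(ler_pM2l p0); apply: le_trans Wj _.
rewrite (_ : 2 ^+ k * (L * M * 8) = 2 * (4 * 2 ^+ k * (L * M))); last by ring.
by rewrite ler_pM2l.
Qed.
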